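(* Let $f=\frac1n\sum_{i=1}^n f_i$ where each $f_i:\mathbb{R}^d\to\mathbb{R}$ is convex and $L_i$-smooth, let $x^*$ be a minimizer of $f$, and let $L_{\max}=\max_{1\le i\le n}L_i$. Let $c=1$, $\gamma_b\in(0,\infty)$ and $\alpha=\min\left\{\frac{1}{2cL_{\max}},\gamma_b\right\}$. Then the iterates of SGD with $\text{SPS}_{\max}$ (with parameters $c=1$ and $\gamma_b$) satisfy, for every $K\ge1$, $$\mathbb{E}\left[f(\bar{x}^K)-f(x^* )\right]\le\frac{\|x^0-x^*\|^2}{\alpha K}+\frac{2\sigma^2\gamma_b}{\alpha},\qquad \bar{x}^K:=\frac1K\sum_{k=0}^{K-1}x^k.$$
   Context: Setting: $f(x)=\frac1n\sum_{i=1}^n f_i(x)$ is minimized over $\mathbb{R}^d$, and the set $\mathcal{X}^*$ of minimizers of $f$ is nonempty. A function is $L$-smooth if it is differentiable with $L$-Lipschitz gradient. For each $i$, $f_i^*:=\inf_x f_i(x)$, and it is assumed throughout that $\sigma^2:=\mathbb{E}_i[f_i(x^* )-f_i^*]=f(x^* )-\frac1n\sum_{i=1}^n f_i^*<\infty$ (so all $f_i^*$ are finite), where $x^*\in\mathcal{X}^*$. SGD: starting from a deterministic $x^0$, at each iteration $k$ an index $i\in\{1,\dots,n\}$ is drawn uniformly at random, independently of the past, and $x^{k+1}=x^k-\gamma_k\nabla f_i(x^k)$. $\text{SPS}_{\max}$ with parameters $c>0$ and $\gamma_b>0$: $\gamma_k=\min\left\{\frac{f_i(x^k)-f_i^*}{c\|\nabla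 f_i(x^k)\|^2},\gamma_b\right\}$, where $i$ is the index drawn at iteration $k$. If $\nabla f_i(x^k)=0$ then $x^{k+1}=x^k$. *)

(* Defs.v *)
From HB Require Import structures.
From mathcomp Require Import all_boot all_order all_algebra.
From mathcomp Require Import all_classical all_reals all_analysis.

Set Implicit Arguments.
Unset Strict Implicit.
Unset Printing Implicit Defensive.

Import Order.TTheory GRing.Theory Num.Theory.
Import numFieldNormedType.Exports.

Local Open Scope classical_set_scope.
Local Open Scope ring_scope.

(** The library norm on ['rV[R]_d] is the sup norm, so the Euclidean one is
    defined here; both induce the same notion of differentiability. *)
Definition enorm (R : realType) (d : nat) (u : 'rV[R]_d) : R :=
  Num.sqrt (\sum_(j < d) u ord0 j ^+ 2).

Definition gradient (R : realType) (d : nat) (g : 'rV[R]_d -> R)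
    (x : 'rV[R]_d) : 'rV[R]_d :=
  \row_(j < d) 'D_(delta_mx ord0 j) g x.

Definition smooth (R : realType) (d : nat) (L : R) (g : 'rV[R]_d -> R) : Prop :=
  (forall x, differentiable g x) /\
  (forall x y, enorm (gradient g x - gradient g y) <= L * enorm (x - y)).

Definition convex (R : realType) (d : nat) (g : 'rV[R]_d -> R) : Prop :=
  @convex_function R 'rV[R]_d setT g.

Definition is_minimizer (R : realType) (d : nat) (g : 'rV[R]_d -> R)
    (xs : 'rV[R]_d) : Prop :=
  forall y, g xs <= g y.

Section FiniteSum.
Variables (R : realType) (d n : nat) (f : 'I_n -> 'rV[R]_d -> R).

Definition favg (x : 'rV[R]_d) : R := n%:R^-1 * \sum_(i < n) f i x.

(** The infimum is taken in the extended reals: it is [-oo] when [f i] is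
    unbounded below. *)
Definition fstar (i : 'I_n) : \bar R := ereal_inf (range (fun x => (f i x)%:E)).

Definition sigma2 (xs : 'rV[R]_d) : \bar R :=
  ((n%:R^-1)%:E * \sum_(i < n) ((f i xs)%:E - fstar i))%E.

Definition sps_max (c gb : R) (i : 'I_n) (x : 'rV[R]_d) : R :=
  Num.min ((f i x - fine (fstar i)) / (c * enorm (gradient (f i) x) ^+ 2)) gb.

Definition sgd_step (c gb : R) (i : 'I_n) (x : 'rV[R]_d) : 'rV[R]_d :=
  if gradient (f i) x == 0 then x
  else x - sps_max c gb i x *: gradient (f i) x.

(** [i k] is the index drawn at iteration [k]. *)
Fixpoint sgd (c gb : R) (x0 : 'rV[R]_d) (i : nat -> 'I_n) (k : nat) :
    'rV[R]_d :=
  if k is k'.+1 then sgd_step c gb (i k') (sgd c gb x0 i k') else x0.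

Definition sgd_mean (c gb : R) (x0 : 'rV[R]_d) (i : nat -> 'I_n) (K : nat) :
    'rV[R]_d :=
  K%:R^-1 *: \sum_(k < K) sgd c gb x0 i k.

End FiniteSum.

(** The default value [0] is harmless, Lipschitz constants being
    nonnegative. *)
Definition Lmax (R : realType) (n : nat) (L : 'I_n -> R) : R :=
  \big[Num.max/0]_(i < n) L i.

(** [min {1 / (2 c Lm), gb}], where [1 / 0] is read as [+oo] instead of the
    library's [0]. *)
Definition sps_alpha (R : realType) (c Lm gb : R) : R :=
  if Lm == 0 then gb else Num.min (1 / (2 * c * Lm)) gb.

(** Each index is uniform on ['I_n] and independent of the indices drawn
    before it. *)
Definition uniform_sampling (R : realType) (disp : measure_display)
    (Omega : measurableType disp) (P : probability Omega R) (n : nat)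
    (I : nat -> Omega -> 'I_n) : Prop :=
  let past k w := [tuple I j w | j < k] in
  [/\ forall k (B : set 'I_n), measurable (I k @^-1` B),
      forall k (i : 'I_n), P (I k @^-1` [set i]) = (n%:R^-1)%:E &
      forall k (A : set (k.-tuple 'I_n)) (B : set 'I_n),
        P ((past k @^-1` A) `&` (I k @^-1` B)) =
        (P (past k @^-1` A) * P (I k @^-1` B))%E].

(* Main.v *)
Require Import Defs.
From HB Require Import structures.
From mathcomp Require Import all_boot all_order all_algebra.
From mathcomp Require Import all_classical all_reals all_analysis.
From mathcomp Require Import ring lra.

Set Implicit Arguments.
Unset Strict Implicit.
Unset Printing Implicit Defensive.

Import Order.TTheory GRing.Theory Num.Theory.
Import numFieldNormedType.Exports.

Local Open Scope classical_set_scope.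
Local Open Scope ring_scope.

(** Write m_i for the infimum of f_i, r_k = |x_k - xs|^2, and
    V = (1/n) sum_i (f_i(xs) - m_i), which is sigma^2.  The heart of the proof
    is a pathwise inequality for the step from x to x' with index i:
<<
      |x' - xs|^2 <= |x - xs|^2 - alpha (f_i(x) - f_i(xs))
                     + 2 gb (f_i(xs) - m_i)              (sgd_step_le)
>>
    To see it, expand the square.  With step size c the cross term is at most
    2 c (f_i(xs) - f_i(x)) by convexity (convex_gradient_le), and the bound
    c |grad f_i(x)|^2 <= f_i(x) - m_i built into the step size turns the
    quadratic term into c (f_i(x) - m_i).  The sum of the two is
    - c (f_i(x) - m_i) + 2 c (f_i(xs) - m_i), where both parentheses are
    nonnegative, so it remains to know that alpha <= c <= gb.  The upper bound
    is the cap in the step size.  The lower bound is the classical estimate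
    |grad f_i|^2 <= 2 L_i (f_i - m_i) for smooth functions (gradient_sqr_le),
    itself a consequence of the descent lemma (smooth_descent).

    Averaging over the uniform index i replaces f_i by f, since the point x
    depends on the earlier indices only.  The inequality then telescopes: the
    expectation of alpha sum_(k < K) (f(x_k) - f(xs)) is at most r_0 + 2 K gb V
    (sgd_energy_le), and convexity passes from the average of the f(x_k) to the
    value of f at the average iterate (favg_mean_le).

    The iterates are functions of a finite word of indices, so finite sums take
    the place of conditional expectations: the expectation of any function of
    the first k indices is an iterated average over words
    (expectation_word_avg), and the induction takes place on these averages. *)

(** * The Euclidean inner product *)

Definition dot (R : realType) (d : nat) (u v : 'rV[R]_d) : R :=
  \sum_(j < d) u ord0 j * v ord0 j.

Lemma dotC (R : realType) (d : nat) (u v : 'rV[R]_d) : dot u v = dot v u.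
Proof. by apply: eq_bigr => j _; rewrite mulrC. Qed.

Lemma dotDl (R : realType) (d : nat) (u v w : 'rV[R]_d) :
  dot (u + v) w = dot u w + dot v w.
Proof. by rewrite -big_split; apply: eq_bigr => j _; rewrite mxE mulrDl. Qed.

Lemma dotZl (R : realType) (d : nat) (a : R) (u v : 'rV[R]_d) :
  dot (a *: u) v = a * dot u v.
Proof. by rewrite mulr_sumr; apply: eq_bigr => j _; rewrite mxE mulrA. Qed.

Lemma dotNl (R : realType) (d : nat) (u v : 'rV[R]_d) : dot (- u) v = - dot u v.
Proof. by rewrite -scaleN1r dotZl mulN1r. Qed.

Lemma dotDr (R : realType) (d : nat) (u v w : 'rV[R]_d) :
  dot u (v + w) = dot u v + dot u w.
Proof. by rewrite dotC dotDl !(dotC _ u). Qed.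

Lemma dotZr (R : realType) (d : nat) (a : R) (u v : 'rV[R]_d) :
  dot u (a *: v) = a * dot u v.
Proof. by rewrite dotC dotZl dotC. Qed.

Lemma dotNr (R : realType) (d : nat) (u v : 'rV[R]_d) : dot u (- v) = - dot u v.
Proof. by rewrite dotC dotNl dotC. Qed.

Lemma dot0r (R : realType) (d : nat) (u : 'rV[R]_d) : dot u 0 = 0.
Proof. by rewrite -(scale0r 0) dotZr mul0r. Qed.

Lemma dot_sumr (R : realType) (d m : nat) (u : 'rV[R]_d)
    (v : 'I_m -> 'rV[R]_d) :
  dot u (\sum_(k < m) v k) = \sum_(k < m) dot u (v k).
Proof.
by apply: (big_morph (dot u)) => [x y|]; [exact: dotDr|exact: dot0r].
Qed.

Lemma dot_ge0 (R : realType) (d : nat) (u : 'rV[R]_d) : 0 <= dot u u.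
Proof. by apply: sumr_ge0 => j _; rewrite -expr2 sqr_ge0. Qed.

Lemma dot_eq0 (R : realType) (d : nat) (u : 'rV[R]_d) :
  (dot u u == 0) = (u == 0).
Proof.
apply/idP/eqP => [|->]; last by rewrite dot0r.
rewrite psumr_eq0 => [/allP h|j _]; last by rewrite -expr2 sqr_ge0.
apply/rowP => j; rewrite mxE; apply/eqP.
by have := h j (mem_index_enum _); rewrite mulf_eq0 orbb.
Qed.

Lemma enorm_sqr (R : realType) (d : nat) (u : 'rV[R]_d) :
  enorm u ^+ 2 = dot u u.
Proof.
have -> : dot u u = \sum_(j < d) u ord0 j ^+ 2.
  by apply: eq_bigr => j _; rewrite expr2.
by rewrite sqr_sqrtr // sumr_ge0 // => j _; rewrite sqr_ge0.
Qed.

Lemma enorm_ge0 (R : realType) (d : nat) (u : 'rV[R]_d) : 0 <= enorm u.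
Proof. exact: sqrtr_ge0. Qed.

Lemma enorm_eq0 (R : realType) (d : nat) (u : 'rV[R]_d) :
  (enorm u == 0) = (u == 0).
Proof. by rewrite -sqrf_eq0 enorm_sqr dot_eq0. Qed.

Lemma enormZ (R : realType) (d : nat) (a : R) (u : 'rV[R]_d) :
  0 <= a -> enorm (a *: u) = a * enorm u.
Proof.
move=> a0; apply/eqP.
rewrite -(eqrXn2 (_ : 0 < 2)%N) ?enorm_ge0 ?mulr_ge0 ?enorm_ge0//.
by rewrite enorm_sqr exprMn enorm_sqr dotZl dotZr mulrA -expr2.
Qed.

(** Cauchy-Schwarz, from the nonnegativity of the square of |v| u - |u| v. *)
Lemma dot_le_enorm (R : realType) (d : nat) (u v : 'rV[R]_d) :
  dot u v <= enorm u * enorm v.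
Proof.
have [/eqP u0|u0] := boolP (u == 0).
  by rewrite u0 dotC dot0r mulr_ge0 ?enorm_ge0.
have [/eqP v0|v0] := boolP (v == 0).
  by rewrite v0 dot0r mulr_ge0 ?enorm_ge0.
have pu : 0 < enorm u by rewrite lt_neqAle eq_sym enorm_eq0 u0 enorm_ge0.
have pv : 0 < enorm v by rewrite lt_neqAle eq_sym enorm_eq0 v0 enorm_ge0.
have := dot_ge0 (enorm v *: u - enorm u *: v).
rewrite !(dotDl, dotDr, dotNl, dotNr, dotZl, dotZr) -!enorm_sqr (dotC v u).
set a := enorm u in pu *; set b := enorm v in pv *; set c := dot u v.
move=> h; suff : 0 <= 2 * (a * b) * (a * b - c).
  by rewrite pmulr_rge0 ?subr_ge0 // mulr_gt0 // mulr_gt0.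
by apply: le_trans h _; rewrite le_eqVlt; apply/orP; left; apply/eqP; ring.
Qed.

(** * First-order inequalities *)

Lemma derive_gradient (R : realType) (d : nat) (g : 'rV[R]_d -> R)
    (x v : 'rV[R]_d) :
  differentiable g x -> 'D_v g x = dot (gradient g x) v.
Proof.
move=> dg; rewrite deriveE // {1}(row_sum_delta v) linear_sum.
apply: eq_bigr => j _; rewrite linearZ /= mxE deriveE // mulrC.
by congr (_ * _).
Qed.

(** The difference quotients of g restricted to a line are those of the
    directional derivative of g, whence the one-variable results apply. *)
Lemma is_derive_line (R : realType) (d : nat) (g : 'rV[R]_d -> R)
    (x v : 'rV[R]_d) (t : R) : differentiable g (x + t *: v) ->
  is_derive t 1 (fun s : R => g (x + s *: v)) (dot (gradient g (x + t *: v)) v).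
Proof.
move=> dg; rewrite -derive_gradient //.
have E : (fun h : R => h^-1 *: (((fun s : R => g (x + s *: v)) \o shift t)
     (h *: (1 : R)) - g (x + t *: v))) =
   (fun h : R => h^-1 *: ((g \o shift (x + t *: v)) (h *: v) - g (x + t *: v))).
  apply/funext => h /=; congr (_ *: (g _ - _)).
  by rewrite /shift /= scalerDl -scalerA scale1r addrCA.
have dd := @diff_derivable _ _ _ g (x + t *: v) v dg.
split; first by rewrite /derivable E.
by rewrite /derive E.
Qed.

(** Convexity bounds the difference quotient of g at x in the direction y - x
    by g y - g x for every step in (0, 1]; let the step tend to 0. *)
Lemma convex_gradient_le (R : realType) (d : nat) (g : 'rV[R]_d -> R)
    (x y : 'rV[R]_d) :
  convex g -> differentiable g x -> g x + dot (gradient g x) (y - x) <= g y.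
Proof.
move=> cg dg; rewrite -lerBrDl -derive_gradient //.
have dd := @diff_derivable _ _ _ g x (y - x) dg.
have cv : (fun h : R => h^-1 *: ((g \o shift x) (h *: (y - x)) - g x)) @ 0^'+
    --> 'D_(y - x) g x.
  by apply: cvg_dnbhs_at_right; apply: cvg_toP.
apply: (cvgr_to_le cv).
near=> h.
have h0 : 0 < h by near: h; exact: nbhs_right_gt.
have h1 : h <= 1 by near: h; exact: nbhs_right_le.
rewrite /= -[_ *: _]/(_ * _) ler_pdivrMl //.
have hi : Itv.spec (@Itv.num_sem R) (Itv.Real `[0%Z, 1%Z]) h.
  by rewrite /= /Itv.num_sem /= num_real in_itv /= ltW.
have : g (h *: y + (1 - h) *: x) <= h * g y + (1 - h) * g x :=
  cg (Itv.mk hi) y x (in_setT _) (in_setT _).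
have -> : h *: y + (1 - h) *: x = h *: (y - x) + x.
  by rewrite scalerBr scalerBl scale1r addrCA addrC.
rewrite /shift /=; lra.
Unshelve. all: by end_near. Qed.

Lemma is_derive_quadratic (R : realType) (a b t : R) :
  is_derive t 1 (fun s : R => s * a + b * (s * s)) (a + 2 * b * t).
Proof.
have h1 := is_deriveM (is_derive_id t (1 : R)) (is_derive_cst a t (1 : R)).
have h2 := is_deriveM (is_derive_cst b t (1 : R))
  (is_deriveM (is_derive_id t (1 : R)) (is_derive_id t (1 : R))).
have h3 := is_deriveD h1 h2.
apply: (is_derive_eq h3).
rewrite /cst /= -![_ *: _]/(_ * _).
ring.
Qed.

(** The descent lemma.  The function psi below, g along the segment from x to
    x + v minus the quadratic bound, has a nonpositive derivative because the
    gradient is L-Lipschitz; the mean value theorem gives psi 1 <= psi 0. *)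
Lemma smooth_descent (R : realType) (d : nat) (L : R) (g : 'rV[R]_d -> R)
    (x v : 'rV[R]_d) : smooth L g ->
  g (x + v) <= g x + dot (gradient g x) v + L / 2 * dot v v.
Proof.
move=> [dg lg].
pose q (t : R) := t * dot (gradient g x) v + L / 2 * dot v v * (t * t).
pose dq (t : R) := dot (gradient g x) v + L * dot v v * t.
have Dq (s : R) : is_derive s 1 q (dq s).
  by apply: is_derive_eq (is_derive_quadratic _ _ s) _; rewrite /dq; field.
pose psi (t : R) := g (x + t *: v) - q t.
pose dpsi (t : R) := dot (gradient g (x + t *: v)) v - dq t.
have Dpsi : forall s : R, is_derive s 1 psi (dpsi s).
  move=> s; have h := @is_derive_line _ _ g x v s (dg _).
  exact: (is_deriveB h (Dq s)).
have [|t t01 E] := MVT (@ltr01 R) (fun s _ => Dpsi s).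
  by apply: derivable_within_continuous => t _; exact: ex_derive.
have {t01} t0 : 0 <= t by move: t01; rewrite in_itv /= => /andP[/ltW].
have : dpsi t <= 0.
  have := le_trans (dot_le_enorm (gradient g (x + t *: v) - gradient g x) v)
    (ler_wpM2r (enorm_ge0 v) (lg _ _)).
  rewrite addrAC subrr add0r enormZ // dotDl dotNl /dpsi /dq -(enorm_sqr v).
  lra.
move: E; rewrite /psi /q scale1r scale0r addr0 subr0 mulr1.
lra.
Qed.

(** A gradient step of length t decreases g by at least
    (t - L t^2 / 2) |grad g x|^2, and cannot bring it below m.  The best choice
    is t = 1 / L; when L = 0 every t is allowed, so the gradient vanishes. *)
Lemma gradient_sqr_le (R : realType) (d : nat) (L m : R) (g : 'rV[R]_d -> R)
    (x : 'rV[R]_d) : 0 <= L -> smooth L g -> (forall y, m <= g y) ->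
  enorm (gradient g x) ^+ 2 <= 2 * L * (g x - m).
Proof.
move=> L0 sg mg; rewrite enorm_sqr; set D := dot _ _.
have D0 : 0 <= D := dot_ge0 _.
have key (t : R) : t * D - L / 2 * t ^+ 2 * D <= g x - m.
  have := smooth_descent x (- t *: gradient g x) sg.
  rewrite !dotZr !dotZl -/D; have := mg (x + - t *: gradient g x); lra.
have [L_gt0|] := ltP 0 L.
  have := key L^-1.
  have -> : L^-1 * D - L / 2 * L^-1 ^+ 2 * D = D / (2 * L).
    by field; rewrite gt_eqF.
  by rewrite ler_pdivrMr ?mulr_gt0 // mulrC.
move=> Lle; have L00 : L = 0 by apply/eqP; rewrite eq_le L0 Lle.
rewrite L00 mulr0 mul0r leNgt; apply/negP => Dp.
(* For a constant gradient this step length would bring g below m. *)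
have := key ((g x - m + 1) / D).
rewrite L00 !mul0r subr0 divfK ?gt_eqF //; lra.
Qed.

(** * The step size and one step of the method *)

Lemma smooth_le (R : realType) (d : nat) (L L' : R) (g : 'rV[R]_d -> R) :
  L <= L' -> smooth L g -> smooth L' g.
Proof.
move=> LL' [dg lg]; split=> // x y; apply: le_trans (lg x y) _.
by rewrite ler_wpM2r // enorm_ge0.
Qed.

Lemma le_Lmax (R : realType) (n : nat) (L : 'I_n -> R) (i : 'I_n) :
  L i <= Lmax L.
Proof. exact: le_bigmax. Qed.

Lemma Lmax_ge0 (R : realType) (n : nat) (L : 'I_n -> R) : 0 <= Lmax L.
Proof. exact: bigmax_ge_id. Qed.

Lemma sps_alpha_gt0 (R : realType) (M gb : R) :
  0 <= M -> 0 < gb -> 0 < sps_alpha 1 M gb.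
Proof.
move=> M0 gb0; rewrite /sps_alpha; case: eqVneq => // Mn0.
by rewrite lt_min gb0 andbT divr_gt0 // !mulr_gt0 // lt_neqAle eq_sym Mn0.
Qed.

Lemma fstar_le (R : realType) (d n : nat) (f : 'I_n -> 'rV[R]_d -> R)
    (i : 'I_n) (y : 'rV[R]_d) :
  fstar f i \is a fin_num -> fine (fstar f i) <= f i y.
Proof.
by move=> fi; rewrite -lee_fin fineK //; apply: ereal_inf_lbound; exists y.
Qed.

(** The adaptive step size never falls below alpha: this is where the constant
    1 / (2 L) comes from.  A zero M is excluded by the nonzero gradient, in
    accordance with 1 / 0 being read as infinite in alpha. *)
Lemma sps_alpha_le_step (R : realType) (d : nat) (M gb m : R)
    (g : 'rV[R]_d -> R) (x : 'rV[R]_d) :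
  0 <= M -> smooth M g -> (forall y, m <= g y) -> gradient g x != 0 ->
  sps_alpha 1 M gb <= Num.min ((g x - m) / enorm (gradient g x) ^+ 2) gb.
Proof.
move=> M0 sg mg gx; have := gradient_sqr_le x M0 sg mg.
have : 0 < enorm (gradient g x) ^+ 2.
  by rewrite enorm_sqr lt_neqAle eq_sym dot_eq0 gx dot_ge0.
move: (enorm _ ^+ 2) => G G0; rewrite /sps_alpha.
have [->|Mn0] := eqVneq M 0; first by rewrite mulr0 mul0r leNgt G0.
have Mp : 0 < M by rewrite lt_neqAle eq_sym Mn0.
move=> GD; rewrite le_min !ge_min lexx orbT andbT mulr1.
by rewrite ler_pdivlMr // mul1r mulrC ler_pdivrMr ?mulr_gt0 // mulrC GD.
Qed.

(** When the gradient vanishes, x minimizes f i by convexity, and staying put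
    satisfies the inequality because f i x <= f i xs.  Otherwise the step size
    c lies between alpha and gb, and c |grad|^2 <= f i x - m, so that expanding
    the square gives the bound. *)
Lemma sgd_step_le (R : realType) (d n : nat) (f : 'I_n -> 'rV[R]_d -> R)
    (L : 'I_n -> R) (gb : R) (xs x : 'rV[R]_d) (i : 'I_n) :
  convex (f i) -> smooth (L i) (f i) -> fstar f i \is a fin_num -> 0 < gb ->
  enorm (sgd_step f 1 gb i x - xs) ^+ 2 <=
    enorm (x - xs) ^+ 2 - sps_alpha 1 (Lmax L) gb * (f i x - f i xs)
    + 2 * gb * (f i xs - fine (fstar f i)).
Proof.
move=> cf sf fi gb0; rewrite /sgd_step /sps_max mul1r.
have a0 := sps_alpha_gt0 (Lmax_ge0 L) gb0.
have fle y := fstar_le y fi.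
have := convex_gradient_le xs cf (sf.1 x).
have := @sps_alpha_le_step _ _ _ gb _ _ x (Lmax_ge0 L)
  (smooth_le (le_Lmax L i) sf) fle.
move: (sps_alpha _ _ _) a0 => a a0.
have := fle x; have := fle xs; move: (fine _) => m mxs mx.
case: eqP => [-> _|/eqP gx /(_ isT)].
  rewrite dotC dot0r addr0 => xle; rewrite -addrA lerDl addr_ge0 //.
    by rewrite -mulrN (mulr_ge0 (ltW a0)) // oppr_ge0 subr_le0.
  by rewrite !mulr_ge0 ?subr_ge0 ?(ltW gb0).
set g := gradient (f i) x in gx *.
set G := enorm g ^+ 2.
have G0 : 0 < G by rewrite /G enorm_sqr lt_neqAle eq_sym dot_eq0 gx dot_ge0.
set c := Num.min _ _ => ac grad.
have cG : c * G <= f i x - m by rewrite -ler_pdivlMr // /c ge_min lexx.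
have cgb : c <= gb by rewrite /c ge_min lexx orbT.
have c0 : 0 <= c by rewrite (le_trans _ ac) // ltW.
have -> : enorm (x - c *: g - xs) ^+ 2 =
    enorm (x - xs) ^+ 2 + 2 * c * dot g (xs - x) + c * (c * G).
  rewrite addrAC /G !enorm_sqr -(opprB x xs).
  rewrite (dotDl (x - xs)) !(dotDr _ (x - xs)) !(dotNl, dotNr, dotZl, dotZr).
  by rewrite (dotC _ g); ring.
have h1 : c * (c * G) <= c * (f i x - m) by exact: ler_wpM2l.
have h2 : c * dot g (xs - x) <= c * (f i xs - f i x).
  by apply: ler_wpM2l => //; rewrite lerBrDl.
have h3 : a * (f i x - m) <= c * (f i x - m) by rewrite ler_wpM2r // subr_ge0.
have h4 : c * (f i xs - m) <= gb * (f i xs - m).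
  by rewrite ler_wpM2r // subr_ge0.
have h5 : 0 <= a * (f i xs - m) by rewrite mulr_ge0 ?subr_ge0 ?(ltW a0).
lra.
Qed.

(** Jensen's inequality for a finite mean, obtained by summing the tangent
    inequality at the mean: the linear terms cancel. *)
Lemma favg_mean_le (R : realType) (d n K : nat) (f : 'I_n -> 'rV[R]_d -> R)
    (x : 'I_K -> 'rV[R]_d) :
  (0 < K)%N -> (forall i, convex (f i)) ->
  (forall i y, differentiable (f i) y) ->
  K%:R * favg f (K%:R^-1 *: \sum_(k < K) x k) <= \sum_(k < K) favg f (x k).
Proof.
move=> K0 cf df; set xb := _ *: _.
have Kn0 : K%:R != 0 :> R by rewrite pnatr_eq0 -lt0n.
rewrite -mulr_sumr mulrCA ler_wpM2l ?invr_ge0 // exchange_big mulr_sumr /=.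
apply: ler_sum => i _; set g := gradient (f i) xb.
have -> : K%:R * f i xb = \sum_(k < K) (f i xb + dot g (x k - xb)).
  rewrite big_split -dot_sumr /= sumr_const card_ord -mulr_natl sumrB.
  rewrite sumr_const card_ord -[xb *+ K]scaler_nat scalerA divff // scale1r.
  by rewrite subrr dot0r addr0 mulr1 mulr_natl.
by apply: ler_sum => k _; exact: convex_gradient_le.
Qed.

(** Every summand of sigma2 is nonnegative, so a single infimum equal to -oo
    would make the whole sum infinite. *)
Lemma sigma2_fin (R : realType) (d n : nat) (f : 'I_n -> 'rV[R]_d -> R)
    (xs : 'rV[R]_d) :
  (0 < n)%N -> (sigma2 f xs < +oo)%E ->
  (forall i, fstar f i \is a fin_num) /\
  sigma2 f xs = (n%:R^-1 * \sum_(i < n) (f i xs - fine (fstar f i)))%:E.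
Proof.
move=> n0 s_fin.
have le_fx i : (fstar f i <= (f i xs)%:E)%E.
  by apply: ereal_inf_lbound; exists xs.
have ge0 i : (0 <= (f i xs)%:E - fstar f i)%E by rewrite sube_ge0 ?le_fx ?orbT.
have fin i : fstar f i \is a fin_num.
  move: s_fin; rewrite /sigma2 (bigD1 i) //=.
  have := le_fx i; case: (fstar f i) => // _.
  rewrite /= addye; last by rewrite -ltNye (lt_le_trans _ (sume_ge0 _ _)).
  by rewrite gt0_muley // lte_fin invr_gt0 ltr0n.
split=> //; rewrite /sigma2 EFinM -sumEFin; congr (_ * _)%E.
by apply: eq_bigr => i _; rewrite EFinB fineK.
Qed.

(** * Averages over words of indices *)

(** The uniform average over words of length k, written by averaging out the
    last letter first, so that conditioning on all indices but the last is the
    unfolding of the definition. *)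
Fixpoint word_avg (R : realType) (n k : nat) (G : seq 'I_n -> R) : R :=
  if k is k'.+1 then
    word_avg k' (fun s => n%:R^-1 * \sum_(i < n) G (rcons s i))
  else G [::].

Lemma word_avg_le (R : realType) (n k : nat) (G H : seq 'I_n -> R) :
  (forall s, size s = k -> G s <= H s) -> word_avg k G <= word_avg k H.
Proof.
elim: k G H => [|k IH] G H GH /=; first exact: GH.
apply: IH => s sk; rewrite ler_wpM2l ?invr_ge0 //.
by apply: ler_sum => i _; apply: GH; rewrite size_rcons sk.
Qed.

Lemma word_avgD_cst (R : realType) (n k : nat) (G : seq 'I_n -> R) (c : R) :
  (0 < n)%N -> word_avg k (fun s => G s + c) = word_avg k G + c.
Proof.
move=> n0; elim: k G => [|k IH] G //=; rewrite -IH; congr word_avg.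
apply/funext => s; rewrite big_split mulrDr /= sumr_const card_ord.
by rewrite -[c *+ n]mulr_natl mulKf // pnatr_eq0 -lt0n.
Qed.

Lemma word_avgZ (R : realType) (n k : nat) (G : seq 'I_n -> R) (c : R) :
  word_avg k (fun s => c * G s) = c * word_avg k G.
Proof.
elim: k G => [|k IH] G //=; rewrite -IH; congr word_avg.
by apply/funext => s; rewrite -mulr_sumr mulrCA.
Qed.

Lemma expectation_finite (R : realType) (disp : measure_display)
    (Omega : measurableType disp) (P : probability Omega R) (T : finType)
    (Z : Omega -> T) (g : T -> R) :
  (forall z, measurable (Z @^-1` [set z])) ->
  'E_P[fun w => g (Z w)]%E =
    (\sum_z g z * fine (P (Z @^-1` [set z])))%:E.
Proof.
move=> mZ; have intZ z : P.-integrable setT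
    (fun w => (g z)%:E * (\1_(Z @^-1` [set z]) w)%:E)%E.
  by apply: integrableZl => //; exact: integrable_indic.
rewrite unlock (_ : (fun w => _) = fun w =>
    (\sum_z (g z)%:E * (\1_(Z @^-1` [set z]) w)%:E)%E); last first.
  apply/funext => w; rewrite (bigD1 (Z w)) //= big1 => [|z zZ].
    by rewrite indicE mem_set // mule1 adde0.
  by rewrite indicE memNset ?mule0 // => /= zE; rewrite zE eqxx in zZ.
rewrite integral_sum // -sumEFin; apply: eq_bigr => z _.
rewrite integralZl //; last exact: integrable_indic.
by rewrite integral_indic // setIT EFinM fineK // fin_num_measure.
Qed.

Lemma measurable_past (R : realType) (disp : measure_display)
    (Omega : measurableType disp) (n : nat) (I : nat -> Omega -> 'I_n)
    (k : nat) (t : k.-tuple 'I_n) :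
  (forall k (B : set 'I_n), measurable (I k @^-1` B)) ->
  measurable ((fun w => [tuple I j w | j < k]) @^-1` [set t]).
Proof.
move=> mI.
have -> : (fun w => [tuple I j w | j < k]) @^-1` [set t] =
    \bigcap_(j in [set: 'I_k]) (I j @^-1` [set tnth t j]).
  apply/seteqP; split => w /=.
    by move=> <- j _ /=; rewrite tnth_mktuple.
  by move=> h; apply: eq_from_tnth => j; rewrite tnth_mktuple; exact: h.
by apply: fin_bigcap_measurable => // j _; exact: mI.
Qed.

(** The tower property: the index drawn at time k is uniform and independent
    of the past, so inside an expectation it can be averaged out.  Both sides
    are finite sums over the values of the past and of the new index, and the
    joint law is the product of the marginals. *)
Lemma expectation_next_index (R : realType) (disp : measure_display)
    (Omega : measurableType disp) (P : probability Omega R) (n : nat)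
    (I : nat -> Omega -> 'I_n) (k : nat) (G : seq 'I_n -> R) :
  uniform_sampling P I ->
  'E_P[fun w => G (mkseq (I^~ w) k.+1)]%E =
  'E_P[fun w => (n%:R^-1 * \sum_(i < n) G (rcons (mkseq (I^~ w) k) i))%R]%E.
Proof.
case=> mI uI iI.
have pastE w : mkseq (I^~ w) k = [tuple I j w | j < k].
  by rewrite /mkseq -val_enum_ord -map_comp.
pose past w := [tuple I j w | j < k].
have mpast t : measurable (past @^-1` [set t]) by exact: measurable_past.
have pre (z : k.-tuple 'I_n * 'I_n) : (fun w => (past w, I k w)) @^-1` [set z] =
    past @^-1` [set z.1] `&` I k @^-1` [set z.2].
  by case: z => t i; apply/seteqP; split => w /= [-> ->].
pose next (z : k.-tuple 'I_n * 'I_n) := G (rcons z.1 z.2).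
pose mean (t : k.-tuple 'I_n) := n%:R^-1 * \sum_(i < n) G (rcons t i).
have -> : (fun w => G (mkseq (I^~ w) k.+1)) = fun w => next (past w, I k w).
  by apply/funext => w; rewrite mkseqS pastE.
have -> : (fun w => n%:R^-1 * \sum_(i < n) G (rcons (mkseq (I^~ w) k) i)) =
    fun w => mean (past w).
  by apply/funext => w; rewrite pastE.
rewrite (expectation_finite P (Z := past)) //.
rewrite (expectation_finite P (Z := fun w => (past w, I k w))); last first.
  by move=> z; rewrite pre; apply: measurableI.
congr EFin.
pose joint (t : k.-tuple 'I_n) (i : 'I_n) :=
  G (rcons t i) * (fine (P (past @^-1` [set t])) * n%:R^-1).
rewrite (eq_bigr (fun z => joint z.1 z.2)) => [|z _]; last first.
  by rewrite pre iI uI fineM ?fin_num_measure.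
rewrite -(pair_bigA _ joint) /=; apply: eq_bigr => t _.
rewrite /mean mulr_sumr mulr_suml; apply: eq_bigr => i _.
by rewrite /joint mulrC -mulrA mulrC mulrAC.
Qed.

Lemma expectation_word_avg (R : realType) (disp : measure_display)
    (Omega : measurableType disp) (P : probability Omega R) (n : nat)
    (I : nat -> Omega -> 'I_n) (k : nat) (G : seq 'I_n -> R) :
  uniform_sampling P I ->
  'E_P[fun w => G (mkseq (I^~ w) k)]%E = (word_avg k G)%:E.
Proof.
move=> hI; elim: k G => [|k IH] G; first exact: (expectation_cst P (G [::])).
rewrite expectation_next_index //.
exact: (IH (fun s => n%:R^-1 * \sum_(i < n) G (rcons s i))).
Qed.

(** * The energy inequality and the convergence rate *)

Lemma sgdS (R : realType) (d n : nat) (f : 'I_n -> 'rV[R]_d -> R) (c gb : R)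
    (x0 : 'rV[R]_d) (i : nat -> 'I_n) (k : nat) :
  sgd f c gb x0 i k.+1 = sgd_step f c gb (i k) (sgd f c gb x0 i k).
Proof. by []. Qed.

Lemma eq_sgd (R : realType) (d n : nat) (f : 'I_n -> 'rV[R]_d -> R) (c gb : R)
    (x0 : 'rV[R]_d) (i j : nat -> 'I_n) (k : nat) :
  (forall l, (l < k)%N -> i l = j l) -> sgd f c gb x0 i k = sgd f c gb x0 j k.
Proof.
elim: k => [|k IH] ij; first by [].
by rewrite !sgdS (ij k (ltnSn k)) (IH (fun l lk => ij l (leqW lk))).
Qed.

(** The quantity alpha * (accumulated gap) + (squared distance to xs) grows on
    average by at most 2 gb sigma^2 per step.  Given the first K indices the
    last iterate is fixed, so averaging the one-step inequality over the next
    index turns f i into the mean of the f i: the term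
    - alpha (f (x_K) - f xs) cancels the gap added by the new iterate.  The
    letter i0 is the default value of nth. *)
Lemma sgd_energy_le (R : realType) (d n K : nat) (f : 'I_n -> 'rV[R]_d -> R)
    (L : 'I_n -> R) (gb : R) (xs x0 : 'rV[R]_d) (i0 : 'I_n) :
  (forall i, convex (f i)) -> (forall i, smooth (L i) (f i)) ->
  (forall i, fstar f i \is a fin_num) -> 0 < gb ->
  word_avg K (fun s =>
      sps_alpha 1 (Lmax L) gb *
        \sum_(k < K) (favg f (sgd f 1 gb x0 (nth i0 s) k) - favg f xs)
      + enorm (sgd f 1 gb x0 (nth i0 s) K - xs) ^+ 2) <=
    enorm (x0 - xs) ^+ 2
    + K%:R * (2 * gb * (n%:R^-1 * \sum_(i < n) (f i xs - fine (fstar f i)))).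
Proof.
move=> cf sf fin gb0; pose x s k := sgd f 1 gb x0 (nth i0 s) k.
have n0 : (0 < n)%N := leq_ltn_trans (leq0n _) (ltn_ord i0).
set a := sps_alpha _ _ _; set V := n%:R^-1 * _.
elim: K => [|K IH]; first by rewrite /= big_ord0 mulr0 add0r mul0r addr0.
rewrite -natr1 mulrDl mul1r addrA.
apply: le_trans (lerD IH (lexx _)); rewrite -word_avgD_cst // [leLHS]/=.
apply: word_avg_le => s sK.
have xE i k : (k <= K)%N -> x (rcons s i) k = x s k.
  move=> kK; apply: eq_sgd => l lk.
  by rewrite nth_rcons sK (leq_trans lk kK).
have stepE i : x (rcons s i) K.+1 = sgd_step f 1 gb i (x s K).
  rewrite {1}/x sgdS nth_rcons sK ltnn eqxx.
  by congr sgd_step; exact: xE.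
pose S := \sum_(k < K) (favg f (x s k) - favg f xs).
pose C := a * (S + (favg f (x s K) - favg f xs)) + enorm (x s K - xs) ^+ 2.
have term i : a * (\sum_(k < K.+1) (favg f (x (rcons s i) k) - favg f xs))
      + enorm (x (rcons s i) K.+1 - xs) ^+ 2 <=
    C + (- a * (f i (x s K) - f i xs) + 2 * gb * (f i xs - fine (fstar f i))).
  rewrite stepE big_ord_recr /= xE //.
  rewrite (eq_bigr (fun k : 'I_K => favg f (x s k) - favg f xs)); last first.
    by move=> k _; rewrite xE // ltnW.
  rewrite -/S.
  have := sgd_step_le xs (x s K) (cf i) (sf i) (fin i) gb0; rewrite -/a /C.
  lra.
have avgE : n%:R^-1 * \sum_(i < n) (C + (- a * (f i (x s K) - f i xs)
      + 2 * gb * (f i xs - fine (fstar f i)))) =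
    C + (- a * (favg f (x s K) - favg f xs) + 2 * gb * V).
  clearbody C; rewrite !big_split /= sumr_const card_ord -[C *+ n]mulr_natl.
  rewrite -!mulr_sumr !mulrDr mulKf ?pnatr_eq0 -?lt0n //.
  rewrite [n%:R^-1 * (- a * _)]mulrCA sumrB mulrBr -/(favg f _) -/(favg f xs).
  by rewrite [n%:R^-1 * (2 * gb * _)]mulrCA -/V; ring.
rewrite -/(x s K) -/S [leRHS](_ : _ = C +
    (- a * (favg f (x s K) - favg f xs) + 2 * gb * V)); last first.
  by rewrite /C; ring.
rewrite -avgE ler_wpM2l ?invr_ge0 //.
by apply: ler_sum => i _; exact: term.
Qed.

Theorem theorem3p4 (R : realType) (d n : nat) (hn : (0 < n)%N)
    (f : 'I_n -> 'rV[R]_d -> R) (L : 'I_n -> R)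
    (hconvex : forall i, convex (f i))
    (hsmooth : forall i, smooth (L i) (f i))
    (xs : 'rV[R]_d) (hxs : is_minimizer (favg f) xs)
    (hsigma : (sigma2 f xs < +oo)%E)
    (gb : R) (hgb : 0 < gb)
    (x0 : 'rV[R]_d)
    (disp : measure_display) (Omega : measurableType disp)
    (P : probability Omega R) (I : nat -> Omega -> 'I_n)
    (hI : uniform_sampling P I) (K : nat) (hK : (1 <= K)%N) :
  let c : R := 1 in
  let alpha := sps_alpha c (Lmax L) gb in
  let xbar := fun w => sgd_mean f c gb x0 (fun k => I k w) K in
  ('E_P[fun w => (favg f (xbar w) - favg f xs)%R] <=
     (enorm (x0 - xs) ^+ 2 / (alpha * K%:R))%:E +
     (2 * gb / alpha)%:E * sigma2 f xs)%E.
Proof.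
cbv zeta; set alpha := sps_alpha 1 (Lmax L) gb.
have [fin sE] := sigma2_fin hn hsigma.
pose i0 := Ordinal hn.
pose H s := favg f (sgd_mean f 1 gb x0 (nth i0 s) K) - favg f xs.
have -> : (fun w => favg f (sgd_mean f 1 gb x0 (I^~ w) K) - favg f xs) =
    fun w => H (mkseq (I^~ w) K).
  apply/funext => w; rewrite /H /sgd_mean; congr (favg f (_ *: _) - _).
  apply: eq_bigr => k _; apply: eq_sgd => l lk.
  by rewrite nth_mkseq // (ltn_trans lk).
rewrite (expectation_word_avg K H hI) sE -EFinM -EFinD lee_fin.
have a0 : 0 < alpha := sps_alpha_gt0 (Lmax_ge0 L) hgb.
have K0 : 0 < K%:R :> R by rewrite ltr0n.
have := sgd_energy_le K xs x0 i0 hconvex hsmooth fin hgb.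
set V := n%:R^-1 * _ => /= energy.
have : alpha * K%:R * word_avg K H <=
    enorm (x0 - xs) ^+ 2 + K%:R * (2 * gb * V).
  apply: le_trans energy; rewrite -word_avgZ; apply: word_avg_le => s _.
  rewrite -mulrA -[leLHS]addr0 lerD ?exprn_ge0 ?enorm_ge0 //.
  rewrite ler_pM2l // /H mulrBr sumrB sumr_const card_ord.
  rewrite -[favg f xs *+ K]mulr_natl lerB //.
  by apply: favg_mean_le => // i y; exact: (hsmooth i).1.
rewrite mulrC -ler_pdivlMr ?mulr_gt0 // => /le_trans; apply.
rewrite le_eqVlt; apply/orP; left; apply/eqP; field.
by rewrite !gt_eqF.
Qed.
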